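(* There exist an OP alphabet $(\Sigma,M)$ and a semiring $\mathbb{K}$ such that there exists a series (weighted language) $S:(\Sigma,M)^+\to K$ which is regular but not strictly regular.
   Context: A semiring $\mathbb{K}=(K,+,\cdot,0,1)$ has $(K,+,0)$ a commutative monoid, $(K,\cdot,1)$ a monoid, both distributive laws, and $0\cdot x=x\cdot 0=0$; multiplication need not be commutative. OP alphabets. An OP alphabet is a pair $(\Sigma,M)$ where $\Sigma$ is a finite alphabet, $\#\notin\Sigma$, and $M$ (the operator precedence matrix, OPM) assigns to each ordered pair of symbols of $\Sigma\cup\{\#\}$ at most one of the relations $\lessdot,\doteq,\gtrdot$ (an entry may be empty); we write $a\lessdot b$, $a\doteq b$, $a\gtrdot b$. Always $\#\lessdot a$ and $a\gtrdot\#$ for all $a\in\Sigma$. For $w=a_1\cdots a_n\in\Sigma^+$ put $a_0=a_{n+1}=\#$. The chain relation $\curvearrowright$ on $\{0,\dots,n+1\}$ is defined inductively: for $i<j$, $i\curvearrowright j$ if there are positions $i=k_1<\dots<k_m=j$ with $a_{k_1}\lessdot a_{k_2}\doteq\dots\doteq a_{k_{m-1}}\gtrdot a_{k_m}$ and, for each $s\in\{1,\dots,m-1\}$, either $k_s+1=k_{s+1}$ or $k_s\curvearrowright k_{s+1}$. The word $w$ is compatible with $M$ if $0\curvearrowright n+1$; $(\Sigma,M)^+$ is the set of all non-empty words over $\Sigma$ compatible with $M$. Automata. A (nondeterministic) OPA over $(\Sigma,M)$ is $(Q,I,F,\delta)$ with $Q$ a finite set of states, $I,F\subseteq Q$ (initial,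 final), and $\delta=(\delta_{\mathrm{shift}},\delta_{\mathrm{push}},\delta_{\mathrm{pop}})$, $\delta_{\mathrm{shift}},\delta_{\mathrm{push}}\subseteq Q\times\Sigma\times Q$, $\delta_{\mathrm{pop}}\subseteq Q\times Q\times Q$. A weighted OPA (wOPA) over $(\Sigma,M)$ and $\mathbb{K}$ is $\mathcal{A}=(Q,I,F,\delta,\mathrm{wt})$ with $(Q,I,F,\delta)$ an OPA and $\mathrm{wt}=(\mathrm{wt}_{\mathrm{shift}},\mathrm{wt}_{\mathrm{push}},\mathrm{wt}_{\mathrm{pop}})$, $\mathrm{wt}_{op}:\delta_{op}\to K$. It is restricted (an rwOPA) if $\mathrm{wt}_{\mathrm{pop}}\equiv 1$. A configuration is $\langle\Pi,q,u\#,k\rangle$ with stack $\Pi\in\bot(\Sigma\times Q)^*$, state $q$, remaining input $u\#$, and $k\in K$. With $a$ the topmost alphabet symbol of $\Pi$ (resp. of the displayed stack; $a=\#$ if the stack is $\bot$) and $b$ the next input symbol, moves are: push: $\langle\Pi,q,bx,k\rangle\vdash\langle\Pi[b,q],r,x,k\cdot\mathrm{wt}_{\mathrm{push}}(q,b,r)\rangle$ if $a\lessdot b$, $(q,b,r)\in\delta_{\mathrm{push}}$; shift: $\langle\Pi[a,p],q,bx,k\rangle\vdash\langle\Pi[b,p],r,x,k\cdot\mathrm{wt}_{\mathrm{shift}}(q,b,r)\rangle$ if $a\doteq b$, $(q,b,r)\in\delta_{\mathrm{shift}}$; pop: $\langle\Pi[a,p],q,bx,k\rangle\vdash\langle\Pi,r,bx,k\cdot\mathrm{wt}_{\mathrm{pop}}(q,p,r)\rangle$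 if $a\gtrdot b$, $(q,p,r)\in\delta_{\mathrm{pop}}$. An accepting run on $w$ is a finite sequence of moves from $\langle\bot,q_I,w\#,1\rangle$ to $\langle\bot,q_F,\#,k\rangle$ with $q_I\in I$, $q_F\in F$; its weight is $\mathrm{wt}(\rho)=k$. The behavior is $[\![\mathcal{A}]\!]:(\Sigma,M)^+\to K$, $[\![\mathcal{A}]\!](w)=\sum_{\rho}\mathrm{wt}(\rho)$, summed over all accepting runs $\rho$ of $\mathcal{A}$ on $w$. A series is a function $S:(\Sigma,M)^+\to K$; it is regular if $S=[\![\mathcal{A}]\!]$ for some wOPA $\mathcal{A}$ and strictly regular if $S=[\![\mathcal{A}]\!]$ for some rwOPA $\mathcal{A}$ (over $(\Sigma,M)$ and $\mathbb{K}$). *)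

(* Defs.v *)
From HB Require Import structures.
From mathcomp Require Import all_boot all_order all_algebra.
From mathcomp Require Import mathcomp_extra boolp classical_sets functions.
From mathcomp Require Import cardinality fsbigop.

Set Implicit Arguments.
Unset Strict Implicit.
Unset Printing Implicit Defensive.

Import GRing.Theory.
Local Open Scope classical_set_scope.
Local Open Scope ring_scope.

(* [PrecLt], [PrecEq], [PrecGt] are the relations ⋖, ≐, ⋗. *)
Inductive prec := PrecLt | PrecEq | PrecGt.

(* The delimiter # is [None]; an empty matrix entry is also [None].  The entry
   (#, #) is left unconstrained. *)
Record opm (Sigma : finType) := OPM {
  opm_rel :> option Sigma -> option Sigma -> option prec;
  opm_hashl : forall a : Sigma, opm_rel None (Some a) = Some PrecLt;
  opm_hashr : forall a : Sigma, opm_rel (Some a) None = Some PrecGt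
}.

Section Words.
Context (Sigma : finType) (M : opm Sigma).
Implicit Types (a b : option Sigma) (w : seq Sigma).

Definition prec_lt a b : Prop := M a b = Some PrecLt.
Definition prec_eq a b : Prop := M a b = Some PrecEq.
Definition prec_gt a b : Prop := M a b = Some PrecGt.

(* a_i for 0 <= i <= n + 1, where w = a_1 ... a_n and a_0 = a_{n+1} = #. *)
Definition letter w (i : nat) : option Sigma :=
  if i is i'.+1 then onth w i' else None.

(* [ks] lists k_1 < ... < k_m, indexed from 0 by [nth].  Here m >= 3: for m = 2
   the pattern would ask for both ⋖ and ⋗ in a single matrix entry. *)
Inductive chain w : nat -> nat -> Prop :=
| Chain (i j : nat) (inner : seq nat) :
    let ks := i :: rcons inner j in
    let m := size ks in
    (3 <= m)%N ->
    sorted ltn ks ->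
    (j <= (size w).+1)%N ->
    prec_lt (letter w (nth 0%N ks 0)) (letter w (nth 0%N ks 1)) ->
    (forall s, (1 <= s)%N -> (s.+2 < m)%N ->
       prec_eq (letter w (nth 0%N ks s)) (letter w (nth 0%N ks s.+1))) ->
    prec_gt (letter w (nth 0%N ks m.-2)) (letter w (nth 0%N ks m.-1)) ->
    (forall s, (s.+1 < m)%N ->
       (nth 0%N ks s).+1 = nth 0%N ks s.+1 \/
       chain w (nth 0%N ks s) (nth 0%N ks s.+1)) ->
    chain w i j.

Definition compatible w : Prop := chain w 0 (size w).+1.

Definition opword : Type := {w : seq Sigma | w <> [::] /\ compatible w}.

End Words.

Section WeightedAutomata.
Context (Sigma : finType) (M : opm Sigma) (K : pzSemiRingType).

(* The weight functions are total; only their values on the corresponding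
   transition relations are ever used. *)
Record wopa := WOPA {
  state : finType;
  init : {set state};
  final : {set state};
  delta_shift : {set state * Sigma * state};
  delta_push : {set state * Sigma * state};
  delta_pop : {set state * state * state};
  wt_shift : state * Sigma * state -> K;
  wt_push : state * Sigma * state -> K;
  wt_pop : state * state * state -> K
}.

Definition restricted (A : wopa) : Prop :=
  forall t, t \in delta_pop A -> wt_pop t = 1.

Section Runs.
Context (A : wopa).

(* (stack, state, remaining input, weight).  The stack is listed from its top,
   with the bottom marker left implicit ([::] is the stack ⊥); the # that ends
   the remaining input is implicit too. *)
Definition config : Type :=
  (seq (Sigma * state A) * state A * seq Sigma * K)%type.

Definition stack_top (Pi : seq (Sigma * state A)) : option Sigma :=
  omap fst (ohead Pi).

Inductive move : config -> config -> Prop :=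
| Push Pi q b x r k :
    prec_lt M (stack_top Pi) (Some b) -> (q, b, r) \in delta_push A ->
    move (Pi, q, b :: x, k) ((b, q) :: Pi, r, x, k * wt_push (q, b, r))
| Shift Pi a p q b x r k :
    prec_eq M (Some a) (Some b) -> (q, b, r) \in delta_shift A ->
    move ((a, p) :: Pi, q, b :: x, k) ((b, p) :: Pi, r, x, k * wt_shift (q, b, r))
| Pop Pi a p q u r k :
    prec_gt M (Some a) (ohead u) -> (q, p, r) \in delta_pop A ->
    move ((a, p) :: Pi, q, u, k) (Pi, r, u, k * wt_pop (q, p, r)).

Fixpoint moves (c : config) (s : seq config) : Prop :=
  if s is c' :: s' then move c c' /\ moves c' s' else True.

(* A run is its non-empty sequence of configurations, split into the initial
   configuration and the rest. *)
Definition run : Type := (config * seq config)%type.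

Definition accepting (w : seq Sigma) (rho : run) : Prop :=
  exists qI qF k,
    [/\ qI \in init A, qF \in final A,
        rho.1 = ([::], qI, w, 1),
        moves rho.1 rho.2 &
        last rho.1 rho.2 = ([::], qF, [::], k)].

Definition run_weight (rho : run) : K := (last rho.1 rho.2).2.

Let transition : finType :=
  ((state A * Sigma * state A) + (state A * Sigma * state A)
   + (state A * state A * state A))%type.

Let fire (c : config) (t : transition) : config :=
  let: (Pi, q, u, k) := c in
  match t with
  | inl (inl (q0, b, r)) => ((b, q) :: Pi, r, behead u, k * wt_push (q0, b, r))
  | inl (inr (q0, b, r)) =>
      (if Pi is (_, p) :: Pi' then (b, p) :: Pi' else Pi, r, behead u,
       k * wt_shift (q0, b, r))
  | inr (q0, p, r) => (behead Pi, r, u, k * wt_pop (q0, p, r))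
  end.

Let potential (c : config) : nat :=
  let: (Pi, _, u, _) := c in (2 * size u + size Pi)%N.

Let finite_moves c : finite_set [set s | moves c s].
Proof.
have succ_fin (c0 : config) : finite_set [set c' | move c0 c'].
  apply: (@sub_finite_set _ _ (fire c0 @` setT)); last exact/finite_image/finite_finset.
  move=> c' /= [Pi q b x r k _ _|Pi a p q b x r k _ _|Pi a p q u r k _ _].
  - by exists (inl (inl (q, b, r))).
  - by exists (inl (inr (q, b, r))).
  - by exists (inr (q, p, r)).
have dec c0 c' : move c0 c' -> (potential c' < potential c0)%N.
  by case=> *; rewrite /potential /= ?mulnS ?addnS ?add2n ?addSn //= !ltnS ?leqnSn.
elim/ltn_ind: {c}(potential c) {-2}c (erefl (potential c)) => n IH c cn.
apply: (@sub_finite_set _ _ ([set [::]] `|`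
  \bigcup_(c' in [set c' | move c c']) (cons c' @` [set s | moves c' s]))).
  by move=> [|c' s] /=; [left|case=> m ms; right; exists c' => //; exists s].
rewrite finite_setU; split; first exact: finite_set1.
apply: bigcup_finite => // c' /= m; apply: finite_image.
by apply: (IH (potential c')) => //; rewrite -cn; exact: dec.
Qed.

Lemma finite_accepting w : finite_set [set rho | accepting w rho].
Proof.
apply: (@sub_finite_set _ _ (\bigcup_(q in [set: state A])
  (pair ([::], q, w, 1) @` [set s | moves ([::], q, w, 1) s]))).
  move=> [c s] /= [qI [qF [k [_ _ /= -> ms _]]]].
  by exists qI => //; exists s.
by apply: bigcup_finite => [|q _]; [exact: finite_finset|exact: finite_image].
Qed.

(* [finite_accepting] guarantees that this finitely supported sum really ranges
   over all accepting runs. *)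
Definition behavior (w : opword M) : K :=
  \sum_(rho \in [set rho | accepting (sval w) rho]) run_weight rho.

End Runs.

Definition series : Type := opword M -> K.

Definition regular (S : series) : Prop :=
  exists A : wopa, forall w, S w = behavior A w.

Definition strictly_regular (S : series) : Prop :=
  exists A : wopa, restricted A /\ forall w, S w = behavior A w.

End WeightedAutomata.

(* Main.v *)
(** Over a one-letter alphabet with [a ⋖ a], every run on [a^n] performs [n]
    pushes followed by [n] pops. Over the semiring of formal languages, the
    automaton with push weight [{x}] and pop weight [{y}] computes
    [a^n |-> {x^n y^n}]. In a restricted automaton only the pushes carry weight.
    Pair the state reached before each push with the state reached after the pop
    that matches it: the accepting runs become the paths of a finite graph,
    weighted along the edges, so the behavior is that of an ordinary weighted
    finite automaton. Pumping a cycle of length [k] on the path for [x^n y^n]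
    repeats a factor [v] and must yield [x^(n+k) y^(n+k)]; hence [v] contains
    both letters, and [v v] cannot be a factor of [x^(n+k) y^(n+k)]. *)
Require Import Defs.
From HB Require Import structures.
From mathcomp Require Import all_boot all_order all_algebra.
From mathcomp Require Import mathcomp_extra boolp classical_sets functions.
From mathcomp Require Import cardinality fsbigop.
From mathcomp Require Import zify.

Set Implicit Arguments.
Unset Strict Implicit.
Unset Printing Implicit Defensive.

Import GRing.Theory.
Local Open Scope classical_set_scope.
Local Open Scope ring_scope.

(** Supplies the cycle to pump: [p2] is a closed walk based at [last s p1]. *)
Lemma repeat_split (T : eqType) (s : T) (p : seq T) : ~~ uniq (s :: p) ->
  exists p1 p2 p3, [/\ p = p1 ++ p2 ++ p3, p2 != [::] &
                       last (last s p1) p2 = last s p1].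
Proof.
elim: p s => [//|t p IH] s.
have [s_in _|s_notin] := boolP (s \in t :: p).
  case/path.splitP: s_in => q1 q2; exists [::], (rcons q1 s), q2.
  by rewrite /= last_rcons; split=> //; case: q1.
rewrite cons_uniq s_notin => /IH[p1 [p2 [p3 [-> p2n e]]]].
by exists (t :: p1), p2, p3.
Qed.

(** * The semiring of formal languages *)

Section Languages.
Variable T : Type.

Definition lang : Type := set (seq T).
HB.instance Definition _ := Choice.on lang.

Definition lang_mul (A B : lang) : lang :=
  [set w | exists u v, [/\ A u, B v & w = u ++ v]].

Fact lang_addA : associative (setU : lang -> lang -> lang).
Proof. exact: setUA. Qed.

Fact lang_addC : commutative (setU : lang -> lang -> lang).
Proof. exact: setUC. Qed.

Fact lang_add0 : left_id (set0 : lang) setU.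
Proof. exact: set0U. Qed.

HB.instance Definition _ := GRing.isNmodule.Build lang lang_addA lang_addC lang_add0.

Fact lang_mulA : associative lang_mul.
Proof.
move=> A B C; apply/seteqP; split=> w /=.
  move=> [u [_ [Au [v [z [Bv Cz ->]]] ->]]].
  by exists (u ++ v), z; rewrite catA; split=> //; exists u, v.
move=> [_ [z [[u [v [Au Bv ->]]] Cz ->]]].
by exists u, (v ++ z); rewrite catA; split=> //; exists v, z.
Qed.

Fact lang_mul1l : left_id ([set [::]] : lang) lang_mul.
Proof.
move=> A; apply/seteqP; split=> w /=; first by move=> [_ [v [-> Av ->]]].
by move=> Aw; exists [::], w.
Qed.

Fact lang_mul1r : right_id ([set [::]] : lang) lang_mul.
Proof.
move=> A; apply/seteqP; split=> w /=.
  by move=> [u [_ [Au -> ->]]]; rewrite cats0.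
by move=> Aw; exists w, [::]; rewrite cats0.
Qed.

Fact lang_mulDl : left_distributive lang_mul (+%R : lang -> lang -> lang).
Proof.
move=> A B C; apply/seteqP; split=> w /=.
  by move=> [u [v [[Au|Bu] Cv ->]]]; [left|right]; exists u, v.
by move=> [] [u [v [Hu Cv ->]]]; exists u, v; split=> //; [left|right].
Qed.

Fact lang_mulDr : right_distributive lang_mul (+%R : lang -> lang -> lang).
Proof.
move=> A B C; apply/seteqP; split=> w /=.
  by move=> [u [v [Au [Bv|Cv] ->]]]; [left|right]; exists u, v.
by move=> [] [u [v [Au Hv ->]]]; exists u, v; split=> //; [left|right].
Qed.

Fact lang_mul0l : left_zero (0 : lang) lang_mul.
Proof. by move=> A; apply/seteqP; split=> w //= [u [v []]]. Qed.

Fact lang_mul0r : right_zero (0 : lang) lang_mul.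
Proof. by move=> A; apply/seteqP; split=> w //= [u [v []]]. Qed.

HB.instance Definition _ := GRing.Nmodule_isPzSemiRing.Build lang lang_mulA
  lang_mul1l lang_mul1r lang_mulDl lang_mulDr lang_mul0l lang_mul0r.

Lemma lang_mulE (A B : lang) w :
  (A * B : lang)%R w <-> exists u v, [/\ A u, B v & w = u ++ v].
Proof. by []. Qed.

Lemma lang_exp1 (x : T) n : ([set [:: x]] : lang) ^+ n = [set nseq n x].
Proof.
elim: n => [//|n IH]; rewrite exprS IH; apply/seteqP; split=> w.
  by case/lang_mulE=> _ [_ [-> -> ->]].
by move=> ->; apply/lang_mulE; exists [:: x], (nseq n x).
Qed.

(** Addition is union, hence idempotent: multiplicities of runs are forgotten, and membership in a
    behavior only asks for one suitable run. *)
Lemma lang_sumE (I : choiceType) (D : set I) (F : I -> lang) w : finite_set D ->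
  (\sum_(i \in D) F i : lang)%R w <-> exists2 i, D i & F i w.
Proof.
move=> Dfin; rewrite fsbig_finite //=.
have -> : (exists2 i, D i & F i w) <->
    exists2 i, i \in finmap.enum_fset (fset_set D) & F i w.
  by split=> -[i Di Fi]; exists i => //; move: Di; rewrite in_fset_set // inE.
elim: (finmap.enum_fset _) => [|i r IH]; first by rewrite big_nil; split=> [|[]].
rewrite big_cons; split.
  case=> [Fi|/IH[j jr Fj]]; first by exists i; rewrite ?mem_head.
  by exists j; rewrite // in_cons jr orbT.
case=> j; rewrite in_cons => /orP[/eqP->|jr] Fj; first by left.
by right; apply/IH; exists j.
Qed.

End Languages.

(** Counting each letter in both equations shows that [v] contains it exactly [k] times; so in
    [v ++ v] some [true] comes before some [false]. *)
Lemma square_blocks n k (u v w : seq bool) : (0 < k)%N ->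
  nseq n false ++ nseq n true = u ++ v ++ w ->
  nseq (n + k) false ++ nseq (n + k) true = u ++ v ++ v ++ w -> False.
Proof.
move=> k_gt0 e1 e2.
have cnt p : (count p v = p false * k + p true * k)%N.
  have := congr1 (count p) e2; have := congr1 (count p) e1.
  rewrite !count_cat !count_nseq; move: (count p u) (count p v) (count p w).
  by case: (p false); case: (p true) => a b c; rewrite ?mul0n ?mul1n; lia.
have has_bool b : b \in v.
  by rewrite -has_pred1 has_count cnt; case: b; rewrite /= ?mul1n; lia.
(* [pairwise implb] says that no [true] precedes a [false]. *)
have constant_sorted b m : pairwise implb (nseq m b).
  by elim: m => //= m ->; rewrite andbT all_nseq implybb orbT.
have: pairwise implb (u ++ v ++ v ++ w).
  rewrite -e2 pairwise_cat !constant_sorted !andbT.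
  by apply/allrelP=> b c /nseqP[-> _].
rewrite !pairwise_cat => /and3P[_ _ /and3P[/allrelP /(_ true false)]].
by rewrite mem_cat !has_bool => /(_ isT isT).
Qed.

(** * The one-letter alphabet *)

Definition unary_rel (a b : option unit) : option prec :=
  match a, b with
  | _, Some _ => Some PrecLt
  | Some _, None => Some PrecGt
  | None, None => None
  end.

Definition unary_opm : opm unit := @OPM unit unary_rel
  (fun _ => erefl) (fun _ => erefl).

(** Chains nest to the right: each [i < n] chains to [n.+1] through [i.+1], which is either the last
    letter or already chained to [n.+1]. *)
Lemma nseq_compatible n : (0 < n)%N -> compatible unary_opm (nseq n tt).
Proof.
rewrite /compatible size_nseq => n_gt0.
have letter_in i : (i < n)%N -> onth (nseq n tt) i = Some tt.
  by move=> lt_in; rewrite onth_nseq lt_in.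
have letter_end : onth (nseq n tt) n = None by rewrite onth_nseq ltnn.
have chain_step i : (i < n)%N -> i.+1 = n \/ chain unary_opm (nseq n tt) i.+1 n.+1 ->
    chain unary_opm (nseq n tt) i n.+1.
  move=> lt_in next; apply: (@Chain _ _ _ i n.+1 [:: i.+1]) => //=.
  - by rewrite ltnSn ltnS lt_in.
  - by rewrite size_nseq.
  - by rewrite /prec_lt /= letter_in; case: (letter (nseq n tt) i).
  - by case=> [|[]].
  - by rewrite /prec_gt /= letter_end letter_in.
  - by case=> [|[|//]] _; [left | case: next => [<-|]; [left | right]].
(* Induction from the right end: [d] counts the letters after position [i.+1]. *)
have ch d i : (d + i).+1 = n -> chain unary_opm (nseq n tt) i n.+1.
  elim: d i => [|d IH] i e; apply: chain_step; [lia | by left | lia |].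
  by right; apply: IH; rewrite addnS.
by apply: (ch n.-1); rewrite addn0 prednK.
Qed.

Lemma nseq_opword n : nseq n.+1 tt <> [::] /\ compatible unary_opm (nseq n.+1 tt).
Proof. by split=> //; exact: nseq_compatible. Qed.

Definition unary_word n : opword unary_opm := exist _ (nseq n.+1 tt) (nseq_opword n).

(** * Runs over the one-letter alphabet *)

Section Runs.
Variables (K : pzSemiRingType) (A : wopa unit K).
Implicit Types (Pi : seq (unit * state A)) (q r : state A) (k : K).

Definition reach (c c' : config A) : Prop :=
  exists2 s, moves unary_opm c s & last c s = c'.

Lemma reach_refl c : reach c c.
Proof. by exists [::]. Qed.

Lemma reach_step c1 c2 c3 : move unary_opm c1 c2 -> reach c2 c3 -> reach c1 c3.
Proof. by move=> m [s ms e]; exists (c2 :: s). Qed.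

Lemma reach_push Pi q r u k c : (q, tt, r) \in delta_push A ->
  reach ((tt, q) :: Pi, r, u, k * wt_push (q, tt, r)) c ->
  reach (Pi, q, tt :: u, k) c.
Proof. by move=> d; apply: reach_step; constructor=> //; case: Pi. Qed.

Lemma reach_pop Pi p q r k c : (q, p, r) \in delta_pop A ->
  reach (Pi, r, [::], k * wt_pop (q, p, r)) c ->
  reach ((tt, p) :: Pi, q, [::], k) c.
Proof. by move=> d; apply: reach_step; constructor. Qed.

(** Backward induction from the final configuration. No entry is ≐, so shifts are impossible; ⋗
    holds only against the delimiter, so a pop forces the remaining input to be empty. *)
Lemma reach_final_ind (q' : state A) k'
    (P : seq (unit * state A) -> state A -> seq unit -> K -> Prop) :
  P [::] q' [::] k' ->
  (forall Pi q r u k, (q, tt, r) \in delta_push A ->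
     P ((tt, q) :: Pi) r u (k * wt_push (q, tt, r)) -> P Pi q (tt :: u) k) ->
  (forall Pi p q r k, (q, p, r) \in delta_pop A ->
     P Pi r [::] (k * wt_pop (q, p, r)) -> P ((tt, p) :: Pi) q [::] k) ->
  forall Pi q u k, reach (Pi, q, u, k) ([::], q', [::], k') -> P Pi q u k.
Proof.
move=> P0 Ppush Ppop Pi q u k [s].
elim: s Pi q u k => [|c s IH] Pi q u k /=; first by move=> _ [-> -> -> ->].
move=> [m ms] fin; move: m ms fin; move e: (Pi, q, u, k) => c0 m.
case: {c0 c} m e => [Pi0 q0 [] x r k0 _ d [-> -> -> ->] ms fin|//|].
  by apply: (Ppush _ _ _ _ _ d); exact: IH ms fin.
move=> Pi0 [] p q0 u0 r k0 gt d [-> -> -> ->] ms fin.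
have u0_nil : u0 = [::] by case: u0 gt {ms fin} => [|[]].
by rewrite u0_nil in ms fin *; apply: (Ppop _ _ _ _ _ d); exact: IH ms fin.
Qed.

Lemma acceptingP w (rho : run A) : accepting unary_opm w rho ->
  exists qI qF, [/\ qI \in init A, qF \in final A &
    reach ([::], qI, w, 1) ([::], qF, [::], run_weight rho)].
Proof.
case: rho => c s [qI [qF [k [i f /= -> ms e]]]]; exists qI, qF; split=> //.
by exists s; rewrite // /run_weight /= e.
Qed.

Lemma reach_accepting w qI qF k : qI \in init A -> qF \in final A ->
  reach ([::], qI, w, 1) ([::], qF, [::], k) ->
  exists2 rho : run A, accepting unary_opm w rho & run_weight rho = k.
Proof.
move=> i f [s ms e]; exists (([::], qI, w, 1), s); last by rewrite /run_weight /= e.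
by exists qI, qF, k.
Qed.

End Runs.

Lemma behaviorE (T : Type) (A : wopa unit (lang T)) (w : opword unary_opm) z :
  behavior A w z <-> exists qI qF (k : lang T), [/\ qI \in init A, qF \in final A,
    reach (A := A) ([::], qI, sval w, 1) ([::], qF, [::], k) & k z].
Proof.
rewrite /behavior lang_sumE; last exact: finite_accepting.
split=> [[rho /acceptingP[qI [qF [i f r]]] kz]|[qI [qF [k [i f r kz]]]]].
  by exists qI, qF, (run_weight rho).
by have [rho acc e] := reach_accepting i f r; exists rho; rewrite ?e.
Qed.

(** * The automaton weighting pushes by [x] and pops by [y] *)

Section PushPop.
Variables (K : pzSemiRingType) (x y : K).

Definition push_pop : wopa unit K :=
  @WOPA unit K unit [set: unit]%SET [set: unit]%SET finset.set0
    [set: _]%SET [set: _]%SET (fun=> 0) (fun=> x) (fun=> y).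

(** Each unread letter still owes a push and a pop, each stack entry only a pop, and all pushes come
    first. *)
Lemma push_pop_weight Pi q u k q' k' :
  reach (A := push_pop) (Pi, q, u, k) ([::], q', [::], k') ->
  k' = k * (x ^+ size u * y ^+ (size u + size Pi)).
Proof.
move: Pi q u k; apply: (@reach_final_ind _ push_pop q' k' (fun Pi _ u k =>
  k' = k * (x ^+ size u * y ^+ (size u + size Pi))))
  => [|Pi q r u k _ ->|Pi p q r k _ ->] /=.
- by rewrite !mulr1.
- by rewrite addnS addSn !exprS !mulrA.
- by rewrite !add0n !expr0 !mul1r exprS mulrA.
Qed.

Lemma push_pop_reach Pi q n k : exists k',
  reach (A := push_pop) (Pi, q, nseq n tt, k) ([::], tt, [::], k').
Proof.
elim: n Pi q k => [|n IH] Pi q k /=.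
  elim: Pi q k => [[] k|[[] p] Pi IH q k]; first by exists k; exact: reach_refl.
  have [k' r] := IH tt (k * y); exists k'; apply: reach_pop r.
  by rewrite finset.in_setT.
have [k' r] := IH ((tt, q) :: Pi) tt (k * x); exists k'; apply: reach_push r.
by rewrite finset.in_setT.
Qed.

End PushPop.

Lemma push_pop_behavior (T : Type) (x y : T) n z :
  behavior (push_pop ([set [:: x]] : lang T) [set [:: y]]) (unary_word n) z <->
  z = nseq n.+1 x ++ nseq n.+1 y.
Proof.
rewrite behaviorE; split.
  move=> [qI [qF [k [_ _ /push_pop_weight -> {k}]]]].
  by rewrite mul1r addn0 size_nseq !lang_exp1 => /lang_mulE[_ [_ [-> -> ->]]].
move=> ->; have [k r] := @push_pop_reach _ ([set [:: x]] : lang T) [set [:: y]] [::] tt n.+1 1.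
exists tt, tt, k; split=> //; try by rewrite finset.in_setT.
rewrite (push_pop_weight r) mul1r addn0 size_nseq !lang_exp1.
by apply/lang_mulE; exists (nseq n.+1 x), (nseq n.+1 y).
Qed.

(** * Restricted automata as weighted graphs *)

Section Restricted.
Variables (K : pzSemiRingType) (A : wopa unit K).

(* A node [(p, r)]: the state [p] before some push, and the state [r] once the
   stack is back to the height it had at that point. *)
Definition node : finType := (state A * state A)%type.

(** One edge packs a push with its matching pop. That pop consults the state stored by the push,
    which is why both are guessed together. *)
Definition edge : rel node := fun s t =>
  ((s.1, tt, t.1) \in delta_push A) && ((t.2, s.1, s.2) \in delta_pop A).

Fixpoint path_weight (s : node) (p : seq node) : K :=
  if p is t :: p' then wt_push (s.1, tt, t.1) * path_weight t p' else 1.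

Lemma path_weight_cat s p1 p2 :
  path_weight s (p1 ++ p2) = path_weight s p1 * path_weight (last s p1) p2.
Proof. by elim: p1 s => [|t p1 IH] s /=; rewrite ?mul1r // IH mulrA. Qed.

(** The pops that empty the stack once the input is read; their weights are all 1 in a restricted
    automaton and are not recorded. *)
Fixpoint unwinds (r : state A) (Pi : seq (unit * state A)) (q' : state A) : Prop :=
  if Pi is (_, p) :: Pi' then
    exists2 r', (r, p, r') \in delta_pop A & unwinds r' Pi' q'
  else r = q'.

(** The path ends on the diagonal because nothing happens between the last push and the first
    pop. *)
Definition node_path (s : node) (p : seq node) : Prop :=
  path edge s p /\ (last s p).1 = (last s p).2.

Lemma node_path_pump s p1 p2 p3 : last (last s p1) p2 = last s p1 ->
  node_path s (p1 ++ p2 ++ p3) -> node_path s (p1 ++ p2 ++ p2 ++ p3).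
Proof.
by move=> e; rewrite /node_path !cat_path !last_cat !e => -[/and3P[-> -> ->]].
Qed.

Hypothesis restA : restricted A.

Lemma reach_path Pi q u k q' k' : reach (A := A) (Pi, q, u, k) ([::], q', [::], k') ->
  exists r p, [/\ node_path (q, r) p, size p = size u, unwinds r Pi q' &
                  k' = k * path_weight (q, r) p].
Proof.
move: Pi q u k; apply: reach_final_ind.
- by exists q', [::]; rewrite mulr1.
- move=> Pi q r u k d [t [p [[pth diag] sz [r' d' un] ->]]].
  (* The unwinding of the longer stack starts by popping the entry just pushed; [r'] is the state
     reached by that pop. *)
  exists r', ((r, t) :: p); split; rewrite /= ?sz ?mulrA //.
  by split=> //=; rewrite pth /edge /= d d'.
- move=> Pi p q r k d [r' [ss [[_ diag]] /size0nil ss0]].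
  rewrite ss0 /= in diag *; rewrite -diag => un ->.
  exists q, [::]; split=> //=; first by exists r.
  by rewrite restA // !mulr1.
Qed.

Lemma path_reach Pi q r p k q' : node_path (q, r) p -> unwinds r Pi q' ->
  reach (A := A) (Pi, q, nseq (size p) tt, k) ([::], q', [::], k * path_weight (q, r) p).
Proof.
elim: p Pi q r k => [|[q1 r1] p IH] Pi q r k [].
  move=> _ /= <-; rewrite mulr1.
  elim: Pi q => [|[[] p] Pi IH] q /= => [->|[r' d un]]; first exact: reach_refl.
  by apply: (reach_pop d); rewrite restA // mulr1; exact: IH.
rewrite /= => /andP[/andP[/= d d'] pth] diag un; apply: (reach_push d).
by rewrite mulrA; apply: IH => //=; exists r.
Qed.

End Restricted.

(** A run starts and ends with the empty stack, so its first node pairs the initial state with the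
    final one. *)
Lemma restricted_behavior (T : Type) (A : wopa unit (lang T)) n z : restricted A ->
  behavior A (unary_word n) z <-> exists s p,
    [/\ s.1 \in init A, s.2 \in final A, node_path s p & size p = n.+1] /\
    path_weight (A := A) s p z.
Proof.
move=> restA; rewrite behaviorE; split.
  move=> [qI [qF [k [i f /(reach_path restA)[r [p [pth sz /= rF ->]]]]]]].
  rewrite {}rF in pth *.
  by rewrite mul1r => kz; exists (qI, qF), p; split=> //; split; rewrite ?sz ?size_nseq.
move=> [[qI qF] [p [[i f pth sz] pz]]].
exists qI, qF, (1 * path_weight (qI, qF) p); split=> //; last by rewrite mul1r.
by rewrite /= -[tt :: _]/(nseq n.+1 tt) -sz; exact: path_reach.
Qed.

(** * Pumping in the graph of nodes *)

Lemma blocks_not_strictly_regular (S : series unary_opm (lang bool)) :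
  (forall n z, S (unary_word n) z <-> z = nseq n.+1 false ++ nseq n.+1 true) ->
  ~ strictly_regular S.
Proof.
move=> SE [A [restA SA]].
pose n := #|node A|.
have: S (unary_word n) (nseq n.+1 false ++ nseq n.+1 true) by apply/SE.
rewrite SA restricted_behavior // => -[s [p [[i f pth sz] pz]]].
(* The path visits [n.+2] nodes, while only [n] exist. *)
have /repeat_split[p1 [p2 [p3 [ep p2n loop]]]] : ~~ uniq (s :: p).
  apply/negP=> /card_uniqP /= e.
  by have := max_card [in s :: p]; rewrite e sz -/n; lia.
move: pz sz pth; rewrite ep !path_weight_cat loop => pz sz pth.
case/lang_mulE: pz => u [_ [pu /lang_mulE[v [w [pv pw ->]] e]]].
pose k := size p2.
have k_gt0 : (0 < k)%N by rewrite lt0n size_eq0.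
apply: (@square_blocks n.+1 k u v w k_gt0 e); apply/esym; rewrite addSn; apply/SE.
rewrite SA restricted_behavior //.
exists s, (p1 ++ p2 ++ p2 ++ p3); split.
  split=> //; first exact: node_path_pump.
  by move: sz; rewrite !size_cat -/k; lia.
(* By [loop], both copies of [p2] are weighted from the same node, so the same word [v] can be
   chosen in each. *)
rewrite !path_weight_cat !loop.
apply/lang_mulE; exists u, (v ++ v ++ w); split=> //.
apply/lang_mulE; exists v, (v ++ w); split=> //.
by apply/lang_mulE; exists v, w.
Qed.

Theorem proposition8 :
  exists (Sigma : finType) (M : opm Sigma) (K : pzSemiRingType)
         (S : series M K),
    regular S /\ ~ strictly_regular S.
Proof.
pose A := push_pop ([set [:: false]] : lang bool) [set [:: true]].
exists unit, unary_opm, (lang bool), (fun w => behavior A w); split.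
  by exists A.
by apply: blocks_not_strictly_regular => n z; exact: push_pop_behavior.
Qed.
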